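(* Let $\bar\rho:\bar\Gamma\to\mathrm{Homeo}(\mathbb S^1)$ be a $\mu$-faithful non-elementary $(\mu,\tau,\sigma)$-representation of an orbifold group $\bar\Gamma$ (with $\tau$ of order $k\ge1$), and let $\bar\rho':\bar\Gamma\to\mathrm{Homeo}(\mathbb S^1)$ be a modification of $\bar\rho$ on a periodic gap. Then $\bar\rho'$ has the almost $(k)$-convergence property if and only if $\bar\rho$ has the almost $(k)$-convergence property.
   Context: **Orbifold group:** the fundamental group of the base orbifold $B$ of a Seifert fibered $3$-manifold with non-empty boundary, i.e. a group with presentation $\langle a_1,b_1,\dots,a_g,b_g,d_1,\dots,d_p,c_1,\dots,c_q\mid d_j^{\alpha_j}=1,\ c_1\cdots c_q=[a_1,b_1]\cdots[a_g,b_g]d_1\cdots d_p\rangle$ ($B$ orientable) or $\langle a_1,\dots,a_g,d_1,\dots,d_p,c_1,\dots,c_q\mid d_j^{\alpha_j}=1,\ c_1\cdots c_q=a_1^2\cdots a_g^2d_1\cdots d_p\rangle$ ($B$ non-orientable), with $q\ge1$. **$(\mu,\tau,\sigma)$-representation.** Here $\mu\subset\mathbb S^1$ is a closed perfect set, and $\tau:\mu\to\mu$ is a cyclic order preserving homeomorphism of order $k$ (without fixed points if $k\ge2$; $\tau=\mathrm{id}$ if $k=1$). For $x\in\mu$ let $[x,\tau(x)]$ be the small arc from $x$ to $\tau(x)$ (for a suitable orientation of $\mathbb S^1$); it is required that $\mathbb S^1=\bigcup_{i=0}^{k-1}[\tau^i(x),\tau^{i+1}(x)]$ with the open arcs $]\tau^i(x),\tau^{i+1}(x)[$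 pairwise disjoint (for $k=1$, $]x,\tau(x)[=\mathbb S^1\setminus\{x\}$). A gap is a component of $\mathbb S^1\setminus\mu$; $\mathcal I$ is the set of gaps; $\sigma:\bar\Gamma\to S(\mathcal I)$ is a morphism to the permutation group of $\mathcal I$. A $(\mu,\tau,\sigma)$-representation is a representation $\bar\rho:\bar\Gamma\to\mathrm{Homeo}(\mathbb S^1)$ such that $\mu$ is the unique minimal closed invariant set; on $\mu$, $\bar\rho(\bar\gamma)\tau=\tau\bar\rho(\bar\gamma)$ if $\bar\rho(\bar\gamma)$ preserves orientation and $\bar\rho(\bar\gamma)\tau=\tau^{-1}\bar\rho(\bar\gamma)$ if it reverses orientation; and the induced action on $\mathcal I$ is $\sigma$. It is non-elementary if it has no finite orbit, and $\mu$-faithful if the action of $\bar\Gamma$ restricted to $\mu$ is faithful. A gap is periodic if its stabilizer in $\bar\Gamma$ is non-trivial. **Modification on a periodic gap.** Let $I_0$ be a periodic gap of a $(\mu,\tau,\sigma)$-representation $\bar\rho$ whose stabilizer is generated by one of the generators $c_i$, let $\mathfrak J$ be the union of the iterates of $I_0$ under $\sigma(\bar\Gamma)$, and let $f_0$ be a homeomorphism of (the closed arc) $I_0$ coinciding with $\bar\rho(c_i)$ on $\partial I_0$. A modification of $\bar\rho$ on $I_0$ by $f_0$ is a $(\mu,\tau,\sigma)$-representation $\bar\rho'$ which coincides with $\bar\rho$ on $\mathbb S^1\setminus\mathfrak J$ and such that $\bar\rho'(c_i)=f_0$ on $I_0$. **Almost $(k)$-convergence property** of $\bar\rho$. For every sequence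 $(\bar\gamma_n)$ in $\bar\Gamma$, up to a subsequence, one of the following holds: (i) $(\bar\rho(\bar\gamma_n))$ is stationary; (ii) there are $a,\bar\gamma\in\bar\Gamma$ and integers $p_n$ such that $\bar\gamma$ preserves a gap of $\mu$ and $\bar\rho(\bar\gamma_n)=\bar\rho(\bar\gamma)^{p_n}\bar\rho(a)$ for all $n$; (iii) there exist two $\tau$-orbits $\{x^-_i\}$, $\{x^+_i\}$ with $x^\pm_{i+1}=\tau(x^\pm_i)$ (indices mod $k$) such that for every $i$ and every compact $K\subset\,]x^-_i,x^-_{i+1}[$, the restriction of $\bar\rho(\bar\gamma_n)$ to $K$ converges uniformly to the point $x^+_i$ (to $x^+_{-i}$ when the $\bar\rho(\bar\gamma_n)$ reverse orientation). *)

(* Defs.v *)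
From HB Require Import structures.
From mathcomp Require Import all_boot all_order all_algebra all_fingroup.
From mathcomp Require Import all_classical all_reals all_analysis.

Set Implicit Arguments.
Unset Strict Implicit.
Unset Printing Implicit Defensive.

Import Order.TTheory GRing.Theory Num.Theory.
Import numFieldNormedType.Exports.

Local Open Scope classical_set_scope.
Local Open Scope ring_scope.

(* A letter is a generator together with a flag telling whether it is
   inverted. *)
Definition word (X : Type) : Type := seq (X * bool).

Section Presentations.
Context {X : Type}.
Implicit Types (R : word X -> word X -> Prop) (u v w : word X).

Definition gen (x : X) : X * bool := (x, false).
Definition geni (x : X) : X * bool := (x, true).

Definition eval_word (G : groupType) (s : X -> G) (w : word X) : G :=
  foldr (fun l g => ((if l.2 then (s l.1)^-1 else s l.1) * g)%g) 1%g w.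

(* Equality in the group with generators X and relations u = v for R u v. *)
Inductive word_eq R : word X -> word X -> Prop :=
| WordRel u v : R u v -> word_eq R u v
| WordCancel x b : word_eq R [:: (x, b); (x, ~~ b)] [::]
| WordRefl u : word_eq R u u
| WordSym u v : word_eq R u v -> word_eq R v u
| WordTrans u v w : word_eq R u v -> word_eq R v w -> word_eq R u w
| WordCat u u' v v' :
    word_eq R u u' -> word_eq R v v' -> word_eq R (u ++ v) (u' ++ v').

(* G is the group < X | R >, the generator x being mapped to s x. *)
Definition presented_by (G : groupType) (s : X -> G) R : Prop :=
  (forall g : G, exists w, eval_word s w = g) /\
  (forall u v, eval_word s u = eval_word s v <-> word_eq R u v).

End Presentations.

(* Surf: generators coming from the genus, indexed by H (the a_i, b_i or the
   a_i); Cone: the d_j; Bdry: the c_i. *)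
Inductive orb_gen (H : Type) (p q : nat) : Type :=
| Surf of H
| Cone of 'I_p
| Bdry of 'I_q.
Arguments Surf {H p q}.
Arguments Cone {H p q}.
Arguments Bdry {H p q}.

Variant orb_rel (H : Type) (p q : nat) (alpha : 'I_p -> nat)
    (surf : word (orb_gen H p q)) :
    word (orb_gen H p q) -> word (orb_gen H p q) -> Prop :=
| ConeRel j : orb_rel alpha surf (nseq (alpha j) (gen (Cone j))) [::]
| BdryRel : orb_rel alpha surf
    [seq gen (Bdry i) | i <- enum 'I_q]
    (surf ++ [seq gen (Cone j) | j <- enum 'I_p]).

(* [a_1, b_1] ... [a_g, b_g] where a_i = inl i and b_i = inr i *)
Definition orientable_surf (g p q : nat) :
    word (orb_gen ('I_g + 'I_g)%type p q) :=
  flatten [seq [:: gen (Surf (inl i)); gen (Surf (inr i));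
                   geni (Surf (inl i)); geni (Surf (inr i))] | i <- enum 'I_g].

(* a_1 ^ 2 ... a_g ^ 2 *)
Definition nonorientable_surf (g p q : nat) : word (orb_gen 'I_g p q) :=
  flatten [seq [:: gen (Surf i); gen (Surf i)] | i <- enum 'I_g].

(* The boundary generators c_i are kept as data since they depend on the
   chosen presentation of G. *)
Definition orbifold_group (G : groupType) (q : nat) (c : 'I_q -> G) : Prop :=
  (0 < q)%N /\
  exists (g p : nat) (alpha : 'I_p -> nat),
    (forall j, 0 < alpha j)%N /\
    ((exists s : orb_gen ('I_g + 'I_g)%type p q -> G,
        presented_by s (orb_rel alpha (orientable_surf g p q)) /\
        (forall i, s (Bdry i) = c i)) \/
     ((0 < g)%N /\
      exists s : orb_gen 'I_g p q -> G,
        presented_by s (orb_rel alpha (nonorientable_surf g p q)) /\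
        (forall i, s (Bdry i) = c i))).

Definition expgz (G : groupType) (x : G) (n : int) : G :=
  match n with Posz m => (x ^+ m)%g | Negz m => (x ^- m.+1)%g end.

Definition unit_circle (R : realType) : set (R * R) :=
  [set p | p.1 ^+ 2 + p.2 ^+ 2 = 1].

Definition circle (R : realType) : Type := set_type (@unit_circle R).

Section Circle.
Context {R : realType}.
Implicit Types (x y z : circle R) (f : circle R -> circle R) (o : bool).

(* The triangle (x, y, z) has positive signed area. *)
Definition ccw x y z : Prop :=
  let: (p, q, r) := (set_val x, set_val y, set_val z) in
  0 < (q.1 - p.1) * (r.2 - p.2) - (q.2 - p.2) * (r.1 - p.1).

(* The cyclic order of the circle oriented counterclockwise if o = true and
   clockwise if o = false. *)
Definition cyclic o x y z : Prop := if o then ccw x y z else ccw z y x.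

(* The arc ]x, y[ for the orientation o, with ]x, x[ the complement of x. *)
Definition open_arc o x y : set (circle R) :=
  [set z | (x = y /\ z <> x) \/ cyclic o x z y].

Definition closed_arc o x y : set (circle R) := open_arc o x y `|` [set x; y].

Definition homeomorphism f : Prop :=
  exists g, [/\ cancel f g, cancel g f, continuous f & continuous g].

(* f restricts to a homeomorphism from A onto A; its values outside of A are
   irrelevant. *)
Definition homeomorphism_on (A : set (circle R)) f : Prop :=
  exists g, [/\ set_fun A A f /\ set_fun A A g,
    {in A, cancel f g}, {in A, cancel g f},
    {within A, continuous f} & {within A, continuous g}].

Definition orientation_preserving f : Prop :=
  forall x y z, ccw x y z -> ccw (f x) (f y) (f z).

Definition orientation_reversing f : Prop :=
  forall x y z, ccw x y z -> ccw (f z) (f y) (f x).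

Definition is_gap (mu I : set (circle R)) : Prop :=
  exists2 x, ~ mu x & I = connected_component (~` mu) x.

Definition gap (mu : set (circle R)) : Type := {I | is_gap mu I}.

End Circle.

Section Data.
Context {R : realType}.
Implicit Types (mu : set (circle R)) (tau : circle R -> circle R) (k : nat).

Definition has_order_on mu tau k : Prop :=
  [/\ (0 < k)%N,
      forall x, mu x -> iter k tau x = x &
      forall j, (0 < j < k)%N -> exists2 x, mu x & iter j tau x <> x].

(* o is an orientation for which the arcs [x, tau x] are the small ones;
   tau is only meaningful on mu. *)
Definition circular_data mu tau k (o : bool) : Prop :=
  [/\ perfect_set mu,
      homeomorphism_on mu tau /\
      (forall x y z, mu x -> mu y -> mu z ->
        ccw x y z -> ccw (tau x) (tau y) (tau z)),
      has_order_on mu tau k,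
      ((1 < k)%N -> forall x, mu x -> tau x <> x) &
      forall x, mu x ->
        \bigcup_(i < k) closed_arc o (iter i tau x) (iter i.+1 tau x) = setT /\
        trivIset `I_k (fun i => open_arc o (iter i tau x) (iter i.+1 tau x))].

Definition permutation_action (G : groupType) (T : Type)
    (sigma : G -> T -> T) : Prop :=
  (forall g, bijective (sigma g)) /\
  (forall g h, sigma (g * h)%g = sigma g \o sigma h).

End Data.

Section Representations.
Context {R : realType} {G : groupType}.
Variables (mu : set (circle R)) (tau : circle R -> circle R).
Variable sigma : G -> gap mu -> gap mu.
Implicit Types rho : G -> circle R -> circle R.

Definition representation rho : Prop :=
  (forall g, homeomorphism (rho g)) /\
  (forall g h, rho (g * h)%g = rho g \o rho h).

Definition closed_invariant rho (A : set (circle R)) : Prop :=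
  [/\ closed A, A !=set0 & forall g, rho g @` A `<=` A].

Definition minimal_invariant rho (A : set (circle R)) : Prop :=
  closed_invariant rho A /\
  (forall B, closed_invariant rho B -> B `<=` A -> B = A).

Definition mts_representation rho : Prop :=
  [/\ representation rho,
      minimal_invariant rho mu /\ (forall A, minimal_invariant rho A -> A = mu),
      (forall g, orientation_preserving (rho g) ->
        forall x, mu x -> rho g (tau x) = tau (rho g x)),
      (* rho g o tau = tau^-1 o rho g *)
      (forall g, orientation_reversing (rho g) ->
        forall x, mu x -> tau (rho g (tau x)) = rho g x) &
      (forall g (I : gap mu), rho g @` sval I = sval (sigma g I))].

Definition non_elementary rho : Prop :=
  forall x, ~ finite_set [set rho g x | g in [set: G]].

Definition faithful_on rho : Prop :=
  forall g, (forall x, mu x -> rho g x = x) -> g = 1%g.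

Definition gap_stabilizer (I : gap mu) : set G := [set g | sigma g I = I].

Definition periodic_gap (I : gap mu) : Prop :=
  exists2 g, gap_stabilizer I g & g <> 1%g.

Definition gap_orbit (I : gap mu) : set (circle R) :=
  \bigcup_g sval (sigma g I).

(* Only the values of f0 on the closure of I0 matter. *)
Definition modification (c0 : G) rho (I0 : gap mu)
    (f0 : circle R -> circle R) rho' : Prop :=
  [/\ periodic_gap I0 /\ gap_stabilizer I0 = range (expgz c0),
      homeomorphism_on (closure (sval I0)) f0 /\
      (forall x, (closure (sval I0) `\` (sval I0)°) x -> f0 x = rho c0 x),
      mts_representation rho',
      (forall g x, ~ gap_orbit I0 x -> rho' g x = rho g x) &
      (forall x, sval I0 x -> rho' c0 x = f0 x)].

(* In the last case the tau-orbits are x^-_i = tau^i xm and x^+_i = tau^i xp,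
   so that x^+_(-i) = tau^(k - i) xp for i < k. *)
Definition almost_convergence (k : nat) (o : bool) rho : Prop :=
  forall u : nat -> G, exists phi : nat -> nat,
  {homo phi : m n / (m < n)%N} /\
  let v := u \o phi in
  [\/ exists N, forall n, (N <= n)%N -> rho (v n) = rho (v N),
      exists (a g : G) (p : nat -> int),
        (exists I : gap mu, rho g @` sval I = sval I) /\
        (forall n, rho (v n) = rho (expgz g (p n)) \o rho a) |
      exists xm xp, [/\ mu xm, mu xp &
        let converges (target : nat -> circle R) :=
          forall i, (i < k)%N -> forall K : set (circle R), compact K ->
          K `<=` open_arc o (iter i tau xm) (iter i.+1 tau xm) ->
          {uniform K, (fun n => rho (v n)) @ \oo --> (fun=> target i)} in
        ((forall n, orientation_preserving (rho (v n))) /\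
          converges (fun i => iter i tau xp)) \/
        ((forall n, orientation_reversing (rho (v n))) /\
          converges (fun i => iter (k - i) tau xp))]].

End Representations.

(* Main.v *)
(* Since [rho] is faithful on [mu], where [rho] and [rho'] agree, alternatives
   (i) and (ii) are statements about the group elements and pass from [rho] to
   [rho'].  Suppose that [rho (v n)] satisfies (iii).  If some gap [h I0] is sent
   to one and the same gap [J] by infinitely many [v n], these [v n] lie in a
   single coset of the stabilizer of [J], which is generated by a conjugate of
   [c i], and (ii) holds along a subsequence.  Otherwise the images
   [v n (h I0)] of each gap eventually leave every finite family of gaps, so
   that their diameters tend to 0, because only finitely many gaps have diameter
   at least [d], for every [d > 0].  As [rho (v n)] and [rho' (v n)] agree off
   the orbit of [I0] and send each gap to the same gap, the uniform convergence
   of [rho (v n)] to a constant passes to [rho' (v n)].  Finally, [rho' g] and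
   [rho g] have the same orientation since they agree on three points.  The roles
   of [rho] and [rho'] can be exchanged. *)
Require Import Defs.
From mathcomp Require Import all_boot all_order all_algebra all_fingroup.
From mathcomp Require Import all_classical all_reals all_analysis.
From mathcomp Require Import ring lra.

Set Implicit Arguments.
Unset Strict Implicit.
Unset Printing Implicit Defensive.

Import Order.TTheory GRing.Theory Num.Theory.
Import numFieldNormedType.Exports.

Local Open Scope classical_set_scope.
Local Open Scope ring_scope.

(** * Signed areas of triangles inscribed in the circle *)

Section CircleTopology.
Context {R : realType}.
Implicit Types x y z : circle R.

(** Twice the signed area of the triangle; its positivity is [ccw] by conversion. *)
Definition area (p q r : R * R) : R :=
  (q.1 - p.1) * (r.2 - p.2) - (q.2 - p.2) * (r.1 - p.1).

Lemma area_rot p q r : area p q r = area q r p.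
Proof. by rewrite /area; ring. Qed.

Lemma area_rev p q r : area r q p = - area p q r.
Proof. by rewrite /area; ring. Qed.

Lemma circle_val_inj : injective (set_val : circle R -> R * R).
Proof. exact: val_inj. Qed.

Lemma circleE x : (set_val x).1 ^+ 2 + (set_val x).2 ^+ 2 = 1.
Proof. exact: (set_valP x). Qed.

Lemma set_val_continuous : continuous (set_val : circle R -> R * R).
Proof. exact: initial_continuous. Qed.

Definition circle_of (p : R * R) (h : p.1 ^+ 2 + p.2 ^+ 2 = 1) : circle R :=
  exist _ p (mem_set h).

Lemma circle_ofK p (h : p.1 ^+ 2 + p.2 ^+ 2 = 1) : set_val (circle_of h) = p.
Proof. by []. Qed.

Lemma continuous_circle (T : topologicalType) (f : T -> circle R) :
  continuous (set_val \o f) -> continuous f.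
Proof. exact: continuous_comp_initial. Qed.

Definition sqdist (p q : R * R) : R := (p.1 - q.1) ^+ 2 + (p.2 - q.2) ^+ 2.

Lemma sqdist_eq0 p q : (sqdist p q == 0) = (p == q).
Proof.
rewrite /sqdist paddr_eq0 ?sqr_ge0// !sqrf_eq0 !subr_eq0.
by case: p q => [? ?] [? ?]; rewrite xpair_eqE.
Qed.

(* The circumradius formula [abc = 4 r S] for [r = 1]. *)
Lemma sqr_area x y z :
  let: (p, q, r) := (set_val x, set_val y, set_val z) in
  4 * area p q r ^+ 2 = sqdist p q * sqdist q r * sqdist p r.
Proof.
have := circleE x; have := circleE y; have := circleE z.
move: (set_val x) (set_val y) (set_val z) => [a b] [c d] [e f] /=.
rewrite /area /sqdist /= => h3 h2 h1.
set u1 := c - a; set u2 := d - b; set v1 := e - a; set v2 := f - b.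
(* With [p] as base point and [u], [v] the two sides at [p], the equations of the circle become
   [|u|^2 = - 2 p.u] and [|v|^2 = - 2 p.v]. *)
have hu : u1 ^+ 2 + u2 ^+ 2 = - 2 * (a * u1 + b * u2).
  by apply/eqP; rewrite -subr_eq0; apply/eqP;
     transitivity ((c ^+ 2 + d ^+ 2) - (a ^+ 2 + b ^+ 2));
     [rewrite /u1 /u2; ring | rewrite h1 h2; ring].
have hv : v1 ^+ 2 + v2 ^+ 2 = - 2 * (a * v1 + b * v2).
  by apply/eqP; rewrite -subr_eq0; apply/eqP;
     transitivity ((e ^+ 2 + f ^+ 2) - (a ^+ 2 + b ^+ 2));
     [rewrite /v1 /v2; ring | rewrite h1 h3; ring].
have -> : (a - c) ^+ 2 + (b - d) ^+ 2 = u1 ^+ 2 + u2 ^+ 2.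
  by rewrite /u1 /u2; ring.
have -> : (a - e) ^+ 2 + (b - f) ^+ 2 = v1 ^+ 2 + v2 ^+ 2.
  by rewrite /v1 /v2; ring.
have -> : (c - e) ^+ 2 + (d - f) ^+ 2 =
    (u1 ^+ 2 + u2 ^+ 2) + (v1 ^+ 2 + v2 ^+ 2) - 2 * (u1 * v1 + u2 * v2).
  by rewrite /u1 /u2 /v1 /v2; ring.
(* The factor [|p|^2 = 1] makes the next equality a polynomial identity: the Gram determinant of the
   plane vectors [p], [u], [v] vanishes. *)
transitivity (4 * (a ^+ 2 + b ^+ 2) * (u1 * v2 - u2 * v1) ^+ 2).
  by rewrite h1; ring.
set A := u1 ^+ 2 + u2 ^+ 2 in hu *; set B := v1 ^+ 2 + v2 ^+ 2 in hv *.
transitivity ((- 2 * (a * u1 + b * u2)) ^+ 2 * B +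
   (- 2 * (a * v1 + b * v2)) ^+ 2 * A - 2 * (- 2 * (a * u1 + b * u2)) *
   (- 2 * (a * v1 + b * v2)) * (u1 * v1 + u2 * v2)).
  by rewrite /A /B; ring.
by rewrite -hu -hv; ring.
Qed.

Lemma area_neq0 x y z : x <> y -> y <> z -> x <> z ->
  area (set_val x) (set_val y) (set_val z) != 0.
Proof.
move=> xy yz xz; have /= h := sqr_area x y z.
have sq (u v : circle R) : u <> v -> sqdist (set_val u) (set_val v) != 0.
  by move=> uv; rewrite sqdist_eq0; apply/eqP => /circle_val_inj.
apply/eqP => a0; move: h; rewrite a0 expr0n mulr0 => /esym/eqP.
rewrite !mulf_eq0.
by rewrite (negbTE (sq _ _ xy)) (negbTE (sq _ _ yz)) (negbTE (sq _ _ xz)).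
Qed.

Lemma ccw_area x y z :
  ccw x y z = (0 < area (set_val x) (set_val y) (set_val z)) :> Prop.
Proof. by []. Qed.

Lemma ccw_neq x y z : ccw x y z -> [/\ x <> y, y <> z & x <> z].
Proof.
by rewrite /ccw => h; split => e; move: h; rewrite e lt_neqAle => /andP[+ _];
  move/eqP; apply; ring.
Qed.

Lemma coord1_continuous : continuous (fun x => (set_val x).1).
Proof.
move=> x; apply: (@continuous_comp _ _ _ set_val fst); last exact: cvg_fst.
exact: set_val_continuous.
Qed.

Lemma coord2_continuous : continuous (fun x => (set_val x).2).
Proof.
move=> x; apply: (@continuous_comp _ _ _ set_val snd); last exact: cvg_snd.
exact: set_val_continuous.
Qed.

Lemma area_continuous (T : topologicalType) (f g h : T -> circle R) :
  continuous f -> continuous g -> continuous h ->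
  continuous (fun t => area (set_val (f t)) (set_val (g t)) (set_val (h t))).
Proof.
have c1 (k : T -> circle R) : continuous k ->
    continuous (fun t => (set_val (k t)).1).
  move=> kc t.
    apply: (@continuous_comp _ _ _ k (fun x : circle R => (set_val x).1)).
      exact: kc.
    exact: coord1_continuous.
have c2 (k : T -> circle R) : continuous k ->
    continuous (fun t => (set_val (k t)).2).
  move=> kc t.
    apply: (@continuous_comp _ _ _ k (fun x : circle R => (set_val x).2)).
      exact: kc.
    exact: coord2_continuous.
move=> fc gc hc t; rewrite /area.
by apply: cvgB; apply: cvgM; apply: cvgB; (apply: c1 => // || apply: c2 => //).
Qed.

End CircleTopology.

(** * Homeomorphisms of the circle preserve or reverse orientation *)

Section Orientation.
Context {R : realType}.
Implicit Types (x y z : circle R) (f g : circle R -> circle R).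

(** Increasing triples form a convex set. Along the segment joining two of them the area varies
    continuously, and a change of sign would produce a zero, against [area_neq0]. *)
Lemma area_triples_sign (h : R -> circle R) : continuous h -> injective h ->
  forall s t u s' t' u', s < t -> t < u -> s' < t' -> t' < u' ->
  0 < area (set_val (h s)) (set_val (h t)) (set_val (h u)) ->
  0 < area (set_val (h s')) (set_val (h t')) (set_val (h u')).
Proof.
move=> hc hi s t u s' t' u' st tu st' tu' a0.
rewrite ltNge; apply/negP => a1.
pose l (a b : R) (r : R) := a + r * (b - a).
have lc a b : continuous (l a b).
  move=> r; apply: cvgD; first exact: cvg_cst.
  by apply: cvgM; [exact: cvg_id | exact: cvg_cst].
pose F r := area (set_val (h (l s s' r))) (set_val (h (l t t' r)))
  (set_val (h (l u u' r))).
have Fc : continuous F.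
  by apply: area_continuous => r; apply: continuous_comp;
    [exact: lc | exact: hc | exact: lc | exact: hc | exact: lc | exact: hc].
have F0 : F 0 = area (set_val (h s)) (set_val (h t)) (set_val (h u)).
  by rewrite /F /l !mul0r !addr0.
have F1 : F 1 = area (set_val (h s')) (set_val (h t')) (set_val (h u')).
  by rewrite /F /l !mul1r !(addrC _ (_ - _)) !subrK.
have [] := @IVT R F 0 1 0 ler01.
- exact: continuous_subspaceT.
- by rewrite F0 F1 ge_min le_max a1 (ltW a0) orbT.
move=> r; rewrite in_itv/= => /andP[r0 r1].
have lt_l a b a' b' : a < b -> a' < b' -> l a a' r < l b b' r.
  rewrite /l => ab ab'.
  have h1 : 0 <= (1 - r) * (b - a) by rewrite mulr_ge0 ?subr_ge0// ltW.
  have [-> | rn0] := eqVneq r 0; first by rewrite !mul0r !addr0.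
  have h2 : 0 < r * (b' - a') by rewrite mulr_gt0 ?subr_gt0// lt0r rn0.
  by rewrite -subr_gt0; nra.
have ltu := lt_l _ _ _ _ tu tu'; have lst := lt_l _ _ _ _ st st'.
have hneq a b : a < b -> h a <> h b.
  by move=> ab /hi e; move: ab; rewrite e ltxx.
apply/eqP; apply: area_neq0; apply: hneq => //.
exact: lt_trans lst ltu.
Qed.

Let sqr1_gt0 (t : R) : 0 < 1 + t ^+ 2.
Proof. by have := sqr_ge0 t; lra. Qed.

Let sqr1_neq0 (t : R) : 1 + t ^+ 2 != 0.
Proof. exact: lt0r_neq0. Qed.

Lemma ratparam_subproof (t : R) :
  ((1 - t ^+ 2) / (1 + t ^+ 2)) ^+ 2 + (2 * t / (1 + t ^+ 2)) ^+ 2 = 1.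
Proof. by field; exact: sqr1_neq0. Qed.

(* Inverse of the stereographic projection from [(-1, 0)]. *)
Definition ratparam (t : R) : circle R :=
  @circle_of R ((1 - t ^+ 2) / (1 + t ^+ 2), 2 * t / (1 + t ^+ 2))
    (ratparam_subproof t).

(** A Vandermonde product over positive factors, so that orientation can be read on the
    parameters. *)
Lemma area_ratparam s t u :
  area (set_val (ratparam s)) (set_val (ratparam t)) (set_val (ratparam u)) =
  4 * ((t - s) * (u - t) * (u - s)) /
    ((1 + s ^+ 2) * (1 + t ^+ 2) * (1 + u ^+ 2)).
Proof.
rewrite /ratparam !circle_ofK /area /=; field.
by rewrite !sqr1_neq0.
Qed.

Lemma ccw_ratparam s t u :
  ccw (ratparam s) (ratparam t) (ratparam u) <->
  0 < (t - s) * (u - t) * (u - s).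
Proof.
rewrite ccw_area area_ratparam.
rewrite pmulr_lgt0; last by rewrite invr_gt0 !mulr_gt0// sqr1_gt0.
by rewrite pmulr_rgt0.
Qed.

Lemma ratparam_inj : injective ratparam.
Proof.
move=> s t e.
have /(congr1 fst)/= e1 := congr1 set_val e.
have /(congr1 snd)/= e2 := congr1 set_val e.
(* The parameter is the slope of the line through the pole [(-1, 0)] and the point. *)
have h v : (set_val (ratparam v)).2 = v * (1 + (set_val (ratparam v)).1).
  by rewrite circle_ofK /=; field; exact: sqr1_neq0.
have n v : 1 + (set_val (ratparam v)).1 != 0.
  rewrite circle_ofK /=.
  have -> : 1 + (1 - v ^+ 2) / (1 + v ^+ 2) = 2 / (1 + v ^+ 2).
    by field; exact: sqr1_neq0.
  by rewrite mulf_neq0 ?invr_neq0// pnatr_eq0.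
by apply: (mulIf (n s)); rewrite -h {2}e -h e.
Qed.

Lemma ratparam_surj x : (set_val x).1 != -1 -> exists t, ratparam t = x.
Proof.
move=> x1; exists ((set_val x).2 / (1 + (set_val x).1)).
apply: circle_val_inj; rewrite circle_ofK.
have := circleE x; move: (set_val x) x1 => [a b] /= a1 ab.
have n : 1 + a != 0.
  by apply: contra_neq a1 => /eqP; rewrite addrC addr_eq0 => /eqP.
have e : 1 + (b / (1 + a)) ^+ 2 = 2 / (1 + a).
  have -> : 1 + (b / (1 + a)) ^+ 2 =
      ((1 + a) ^+ 2 + b ^+ 2) / (1 + a) ^+ 2 by field.
  have -> : (1 + a) ^+ 2 + b ^+ 2 = 2 * (1 + a) by lra.
  by field.
rewrite e; congr (_, _); last by field.
have -> : 1 - (b / (1 + a)) ^+ 2 = 2 - 2 / (1 + a) by rewrite -e; ring.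
by field.
Qed.

Lemma ratparam_continuous : continuous ratparam.
Proof.
apply: continuous_circle => t.
have sc : {for t, continuous (fun v : R => 1 + v ^+ 2)}.
  by apply: cvgD; [exact: cvg_cst | exact: exprn_continuous].
have ic : {for t, continuous (fun v : R => (1 + v ^+ 2)^-1)}.
  by apply: cvgV => //; exact: sqr1_neq0.
pose fst' v : R := (1 - v ^+ 2) / (1 + v ^+ 2).
pose snd' v : R := 2 * v / (1 + v ^+ 2).
have fc : fst' @ t --> fst' t.
  by apply: cvgM => //; apply: cvgB; [exact: cvg_cst | exact: exprn_continuous].
have gc : snd' @ t --> snd' t.
  by apply: cvgM => //; apply: cvgM; [exact: cvg_cst | exact: cvg_id].
exact: (cvg_pair fc gc).
Qed.

Lemma antipode_subproof x :
  (- (set_val x).1) ^+ 2 + (- (set_val x).2) ^+ 2 = 1.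
Proof. by rewrite !sqrrN circleE. Qed.

(** Composed with [ratparam], it parametrizes a neighbourhood of the pole [(-1, 0)], which
    [ratparam] itself misses. *)
Definition antipode x : circle R :=
  @circle_of R (- (set_val x).1, - (set_val x).2) (antipode_subproof x).

Lemma antipode_continuous : continuous antipode.
Proof.
apply: continuous_circle => x.
have fc : - (set_val y).1 @[y --> x] --> - (set_val x).1.
  exact: (cvgN (@coord1_continuous R x)).
have gc : - (set_val y).2 @[y --> x] --> - (set_val x).2.
  exact: (cvgN (@coord2_continuous R x)).
exact: (cvg_pair fc gc).
Qed.

Lemma circle_pole x y : (set_val x).1 = -1 -> (set_val y).1 = -1 -> x = y.
Proof.
have h z : (set_val z).1 = -1 -> set_val z = (-1, 0).
  have := circleE z; case: (set_val z) => [a b] /= + e.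
  rewrite e sqrrN expr1n => /eqP.
  by rewrite addrC -subr_eq0 addrK sqrf_eq0 => /eqP ->.
by move=> /h hx /h hy; apply: circle_val_inj; rewrite hx.
Qed.

(* The triples containing the pole [(-1, 0)] of the parametrization are
   reached by moving the pole slightly. *)
Lemma area_sign (e : R) f : continuous f -> injective f -> e != 0 ->
  (forall s t u, s < t -> t < u ->
    0 < e * area (set_val (f (ratparam s))) (set_val (f (ratparam t)))
      (set_val (f (ratparam u)))) ->
  forall x y z, ccw x y z ->
    0 < e * area (set_val (f x)) (set_val (f y)) (set_val (f z)).
Proof.
move=> fc fi e0 H.
have step1 x y z : (set_val x).1 != -1 -> (set_val y).1 != -1 ->
    (set_val z).1 != -1 -> ccw x y z ->
    0 < e * area (set_val (f x)) (set_val (f y)) (set_val (f z)).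
  move=> /ratparam_surj[s <-] /ratparam_surj[t <-] /ratparam_surj[u <-].
  move=> /ccw_ratparam h.
  (* Positivity of the product means that [s], [t], [u] increase up to a cyclic rotation, under
     which the area is invariant. *)
  have [st|ts|st] := ltgtP s t; have [tu|ut|tu] := ltgtP t u.
  - exact: H.
  - have us : u < s.
      have n : (t - s) * (u - t) < 0 by rewrite pmulr_rlt0 ?subr_gt0// subr_lt0.
      by move: h; rewrite (nmulr_rgt0 _ n) subr_lt0.
    by rewrite area_rot area_rot; apply: H.
  - by move: h; rewrite tu subrr mulr0 mul0r ltxx.
  - have us : u < s.
      have n : (t - s) * (u - t) < 0 by rewrite nmulr_rlt0 ?subr_lt0// subr_gt0.
      by move: h; rewrite (nmulr_rgt0 _ n) subr_lt0.
    by rewrite area_rot; apply: H.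
  - have n : 0 < (t - s) * (u - t) by rewrite nmulr_rgt0 subr_lt0.
    have su : s < u by move: h; rewrite (pmulr_rgt0 _ n) subr_gt0.
    by have := lt_trans (lt_trans ut ts) su; rewrite ltxx.
  - by move: h; rewrite tu subrr mulr0 mul0r ltxx.
  - by move: h; rewrite st subrr !mul0r ltxx.
  - by move: h; rewrite st subrr !mul0r ltxx.
  - by move: h; rewrite st subrr !mul0r ltxx.
(* A wrong sign would be strict, hence would persist when the pole [x] is replaced by
   [antipode (ratparam v)] with [v] small and nonzero. The moved triple is still counterclockwise
   and avoids the pole, against [step1]. *)
have step2 x y z : (set_val x).1 = -1 -> ccw x y z ->
    0 < e * area (set_val (f x)) (set_val (f y)) (set_val (f z)).
  move=> x1 xyz; rewrite ltNge; apply/negP => a0.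
  have [xy yz xz] := ccw_neq xyz.
  have {}a0 : e * area (set_val (f x)) (set_val (f y)) (set_val (f z)) < 0.
    rewrite lt_neqAle a0 andbT mulf_neq0//.
    by apply: area_neq0 => /fi.
  have gc : continuous (antipode \o ratparam).
    move=> v; apply: continuous_comp; first exact: ratparam_continuous.
    exact: antipode_continuous.
  have g0 : antipode (ratparam 0) = x.
    by apply: circle_pole => //=; rewrite expr0n subr0 addr0 divr1.
  have cstc (w : circle R) : continuous (fun _ : R => w).
    exact: cst_continuous.
  pose F1 v := area (set_val (antipode (ratparam v))) (set_val y) (set_val z).
  pose F2 v := e * area (set_val (f (antipode (ratparam v)))) (set_val (f y))
    (set_val (f z)).
  have F1c : continuous F1.
    exact: (@area_continuous _ _ (antipode \o ratparam) (fun=> y) (fun=> z)).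
  have F2c : continuous F2.
    move=> v; apply: cvgM; first exact: cvg_cst.
    apply: (@area_continuous _ _ (f \o (antipode \o ratparam)) (fun=> f y)
      (fun=> f z)) => // w.
    by apply: continuous_comp; [exact: gc | exact: fc].
  have n1 : \forall v \near 0, 0 < F1 v.
    by have := @cvgr_gt _ _ (nbhs 0) _ F1 _ (F1c 0) 0; apply; rewrite /F1 g0.
  have n2 : \forall v \near 0, F2 v < 0.
    by have := @cvgr_lt _ _ (nbhs 0) _ F2 _ (F2c 0) 0; apply; rewrite /F2 g0.
  have near0 : \forall v \near (0 : R)^', [/\ 0 < F1 v, F2 v < 0 & v != 0].
    near=> v; split.
    - by near: v; apply: nbhs_dnbhs.
    - by near: v; apply: nbhs_dnbhs.
    - by near: v; exact: nbhs_dnbhs_neq.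
  have [v [v1 v2 v0]] :=
    @filter_ex _ _ (Proper_dnbhs_numFieldType (0 : R)) _ near0.
  move: v2; apply/negP; rewrite -leNgt ltW//; apply: step1 => //.
  - rewrite /= eqr_opp; apply/eqP => /(congr1 (fun r => r * (1 + v ^+ 2))).
    rewrite divfK// mul1r => /eqP; rewrite -subr_eq0 => h.
    have : v ^+ 2 == 0 by apply/eqP; move/eqP: h; lra.
    by rewrite sqrf_eq0 (negbTE v0).
  - by apply/eqP => y1; apply: xy; exact: circle_pole.
  - by apply/eqP => z1; apply: xz; exact: circle_pole.
move=> x y z h.
have [x1|x1] := eqVneq (set_val x).1 (-1); first exact: step2.
have [y1|y1] := eqVneq (set_val y).1 (-1).
  by rewrite area_rot; apply: step2 => //; rewrite ccw_area -area_rot.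
have [z1|z1] := eqVneq (set_val z).1 (-1).
  by rewrite -area_rot; apply: step2 => //; rewrite ccw_area area_rot.
exact: step1.
Unshelve. all: by end_near.
Qed.

(** The image of the single triple of parameters 0, 1, 2 decides: [area_triples_sign] carries its
    sign to all increasing triples and [area_sign] to the whole circle, with [e] equal to 1 or
    -1. *)
Lemma homeomorphism_orientation f : homeomorphism f ->
  orientation_preserving f \/ orientation_reversing f.
Proof.
case=> f' [fK _ fc _]; have fi := can_inj fK.
pose h := f \o ratparam.
have hc : continuous h.
  by move=> t; apply: continuous_comp; [exact: ratparam_continuous | exact: fc].
have hi : injective h := inj_comp fi ratparam_inj.
have [pos|npos] :=
  boolP (0 < area (set_val (h 0)) (set_val (h 1)) (set_val (h 2))).
  left=> x y z xyz; rewrite ccw_area -[area _ _ _]mul1r.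
  apply: area_sign => // s t u st tu.
  by rewrite mul1r; apply: (area_triples_sign hc hi _ _ st tu pos); lra.
right=> x y z xyz; rewrite ccw_area area_rev -mulN1r.
apply: area_sign => // s t u st tu.
rewrite mulN1r oppr_gt0 ltNge le_eqVlt negb_or eq_sym; apply/andP; split.
  apply: area_neq0 => /hi e; first 2 last.
  - by have := lt_trans st tu; rewrite e ltxx.
  - by move: st; rewrite e ltxx.
  - by move: tu; rewrite e ltxx.
apply: contra npos => pos.
by apply: (area_triples_sign hc hi st tu _ _ pos); lra.
Qed.

Lemma ccw_total x y z : x <> y -> y <> z -> x <> z -> ccw x y z \/ ccw z y x.
Proof.
move=> xy yz xz; have := area_neq0 xy yz xz.
rewrite !ccw_area (area_rev (set_val x)) oppr_gt0 neq_lt.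
by case/orP; [right | left].
Qed.

(** If [g] had the other orientation, the common image of the triple would be oriented both ways. *)
Lemma orientation_eq_on3 f g x y z : x <> y -> y <> z -> x <> z ->
  homeomorphism g -> f x = g x -> f y = g y -> f z = g z ->
  (orientation_preserving f -> orientation_preserving g) /\
  (orientation_reversing f -> orientation_reversing g).
Proof.
move=> xy yz xz gh fx fy fz.
have excl (a b c : circle R) : ccw a b c -> ccw c b a -> False.
  rewrite !ccw_area (area_rev (set_val a)) oppr_gt0 => /lt_trans h /h.
  by rewrite ltxx.
have [go|go] := homeomorphism_orientation gh; split=> // fo; exfalso;
  have [h|h] := ccw_total xy yz xz;
  by have := fo _ _ _ h; rewrite fx fy fz; apply: excl; exact: go.
Qed.

End Orientation.

(** * Compactness of the circle and finite sets meeting all large connected sets *)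

Section CircleMetric.
Context {R : realType}.
Implicit Types (x y z : circle R).

(** A Lebesgue number: half of a radius valid at [w] works at all points near [w], and compactness,
    as near covering, makes the radius uniform. *)
Lemma compact_subset_open_ball (X : pseudoMetricType R) (K A : set X) :
  compact K -> open A -> K `<=` A ->
  exists2 e : R, 0 < e & forall x : X, K x -> ball x e `<=` A.
Proof.
move=> /compact_near_coveringP cK oA KA.
have := cK R 0^'+ (fun e (w : X) => ball w e `<=` A) _.
case.
  move=> w Kw; have /nbhs_ballP[e /= e0 eA] : nbhs w A.
    by apply: open_nbhs_nbhs; split => //; exact: KA.
  exists (ball w (e / 2), [set r | r < e / 2]).
    split; first by apply: nbhsx_ballx; rewrite divr_gt0.
    by apply: nbhs_right_lt; rewrite divr_gt0.
  move=> [y r] /= [xy re] z yz; apply: eA.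
  by apply: (ball_split xy); apply: le_ball yz; exact: ltW.
move=> e /= e0 h; exists (e / 2); first by rewrite divr_gt0.
apply: h; rewrite ?divr_gt0//=.
by rewrite sub0r normrN gtr0_norm ?divr_gt0// gtr_pMr// invf_lt1// ltr1n.
Qed.

Lemma ball_circle x y (e : R) : ball x e y <->
  `|(set_val x).1 - (set_val y).1| < e /\ `|(set_val x).2 - (set_val y).2| < e.
Proof. by []. Qed.

Let sqr_le1 (a : R) : a ^+ 2 <= 1 -> `|a| <= 1.
Proof. by rewrite -real_normK ?num_real// expr_le1. Qed.

(** The parameters in [[-1, 1]] cover the half circle of nonnegative first coordinate, and the
    antipode covers the other half. *)
Lemma circle_compact : compact [set: circle R].
Proof.
pose I := `[(-1 : R), 1]%classic.
have cI : compact (ratparam @` I).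
  apply: continuous_compact; last exact: segment_compact.
  by apply: continuous_subspaceT => t; exact: ratparam_continuous.
have cJ : compact (antipode @` (ratparam @` I)).
  apply: continuous_compact => //.
  by apply: continuous_subspaceT => t; exact: antipode_continuous.
have half x : 0 <= (set_val x).1 -> (ratparam @` I) x.
  move=> x0; have [|t tx] := @ratparam_surj R x.
    by apply/eqP => e; move: x0; rewrite e; lra.
  exists t => //; rewrite /I /= in_itv/=.
  have t0 : 0 < 1 + t ^+ 2 by have := sqr_ge0 t; lra.
  move: x0; rewrite -tx /= pmulr_lge0 ?invr_gt0// subr_ge0 => /sqr_le1.
  by rewrite ler_norml.
apply: subclosed_compact (closedT) (compactU cI cJ) _.
move=> x _; have [x0|x0] := leP 0 (set_val x).1; [left; exact: half|right].
exists (antipode x); first by apply: half; rewrite /= oppr_ge0 ltW.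
apply: circle_val_inj; rewrite /antipode !circle_ofK /= !opprK.
by case: (set_val x).
Qed.

Lemma open_open_arc (o : bool) x y : open (open_arc o x y).
Proof.
have cstc (w : circle R) : continuous (fun _ : circle R => w).
  exact: cst_continuous.
have idc : continuous (fun w : circle R => w) by move=> v U; rewrite nbhs_filterE.
have oA (f : circle R -> R) : continuous f -> open [set z | 0 < f z].
  by move=> fc; apply: (@open_comp _ _ f [set r | 0 < r]) => //; exact: open_gt.
have oc : open [set z | cyclic o x z y].
  by case: (o); apply: oA; apply: area_continuous.
have -> : open_arc o x y = [set z | x = y /\ z <> x] `|` [set z | cyclic o x z y].
  by [].
apply: openU => //.
have [->|xy] := pselect (x = y); last first.
  have -> : [set z | x = y /\ z <> x] = set0 by apply/seteqP; split => // z [].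
  exact: open0.
have -> : [set z | y = y /\ z <> y] = ~` [set y].
  by apply/seteqP; split => z // [].
have -> : ~` [set y] = (fun z => (set_val z).1) @^-1` [set r | r != (set_val y).1]
    `|` (fun z => (set_val z).2) @^-1` [set r | r != (set_val y).2].
  apply/seteqP; split => z /=; last by move=> + zy; rewrite zy !eqxx => -[].
  move=> zy; apply/orP; rewrite -negb_and; apply/negP => /andP[/eqP z1 /eqP z2].
  apply: zy; apply: circle_val_inj.
  by rewrite [LHS]surjective_pairing z1 z2 -surjective_pairing.
apply: openU; apply: open_comp; [|exact: open_neq| |exact: open_neq] => z _.
  exact: coord1_continuous.
exact: coord2_continuous.
Qed.

(* For [M > 0], the multiples of [1 / M] in [-1, 1]. *)
Definition grid (M : nat) (j : 'I_(2 * M).+1) : R := (j%:R - M%:R) / M%:R.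

Lemma grid_between (M : nat) (a b : R) : (0 < M)%N ->
  -1 <= a -> b <= 1 -> M%:R^-1 < b - a -> exists j, a <= @grid M j <= b.
Proof.
move=> M0 a1 b1 Mab; have M0' : 0 < M%:R :> R by rewrite ltr0n.
have ab : a < b by rewrite -subr_gt0; apply: lt_trans Mab; rewrite invr_gt0.
have bM0 : 0 <= (b + 1) * M%:R by rewrite mulr_ge0//; lra.
(* The index of the largest multiple of [1 / M] not exceeding [b], shifted by [M]. *)
have /andP[h1 h2] := truncn_itv bM0.
set j := Num.truncn _ in h1 h2.
have jM : (j < (2 * M).+1)%N.
  rewrite ltnS -(ler_nat R) (le_trans h1)// natrM ler_pM2r//; lra.
exists (Ordinal jM); rewrite /grid /= ler_pdivlMr// ler_pdivrMr//.
apply/andP; split; last by move: h1; rewrite mulrDl mul1r; lra.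
have : 1 < (b - a) * M%:R by rewrite -ltr_pdivrMr// div1r.
by move: h2; rewrite -natr1 !mulrDl mulNr mul1r; lra.
Qed.

(** Two points not within [d] differ by at least [d] in some coordinate. On a connected set this
    coordinate takes every value in between, one of them on a grid of mesh less than [d], and only
    finitely many points of the circle have a coordinate on the grid. *)
Lemma finite_transversal (d : R) : 0 < d ->
  exists2 F : set (circle R), finite_set F &
    forall (C : set (circle R)) x y, connected C -> C x -> C y ->
      ~ ball x d y -> C `&` F !=set0.
Proof.
move=> d0.
have [M [M0 Md]] : exists M, (0 < M)%N /\ (M%:R^-1 < d :> R).
  exists (Num.truncn d^-1).+1; split => //.
  rewrite -[ltRHS]invrK ltf_pV2 ?posrE ?invr_gt0// ?ltr0n//.
  have di : 0 <= d^-1 by rewrite invr_ge0 ltW.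
  by have /andP[] := truncn_itv di.
(* The first flag is the sign of the root giving the other coordinate; the second tells whether the
   grid value is the first coordinate. *)
pose pt (i : 'I_(2 * M).+1 * (bool * bool)) : R * R :=
  let c := grid i.1 in let s := (-1) ^+ i.2.1 * Num.sqrt (1 - c ^+ 2) in
  if i.2.2 then (c, s) else (s, c).
exists (set_val @^-1` (range pt)).
  apply: finite_preimage; last exact: finite_image finite_finset.
  by move=> ? ? _ _; exact: circle_val_inj.
(* Both coordinates are treated at once: [pi] is the one that varies by [d], [pi'] the other one. *)
have main (pi pi' : circle R -> R) (b : bool) (C : set (circle R)) x y :
    (forall z, pi z ^+ 2 + pi' z ^+ 2 = 1) ->
    (forall z, set_val z = if b then (pi z, pi' z) else (pi' z, pi z)) ->
    continuous pi ->
    connected C -> C x -> C y -> d <= pi y - pi x ->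
    C `&` (set_val @^-1` (range pt)) !=set0.
  move=> pi1 piE pic cC Cx Cy dxy.
  have pi_le z : `|pi z| <= 1.
    by apply: sqr_le1; have := pi1 z; have := sqr_ge0 (pi' z); lra.
  have [|||j /andP[xj jy]] := @grid_between M (pi x) (pi y) M0.
  - by have := pi_le x; rewrite ler_norml => /andP[].
  - by have := pi_le y; rewrite ler_norml => /andP[].
  - exact: lt_le_trans dxy.
  have /connected_intervalP iC : connected (pi @` C).
    by apply: connected_continuous_connected => //; exact: continuous_subspaceT.
  have [z Cz zj] : (pi @` C) (grid j).
    by apply: (iC (pi x) (pi y)); [exists x | exists y | rewrite xj jy].
  exists z; split => //=.
  have [e pi'z] : exists e : bool, pi' z = (-1) ^+ e * Num.sqrt (1 - grid j ^+ 2).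
    have : pi' z ^+ 2 == Num.sqrt (1 - grid j ^+ 2) ^+ 2.
      have h : 1 - grid j ^+ 2 = pi' z ^+ 2 by rewrite -zj -(pi1 z); ring.
      by rewrite sqr_sqrtr h// sqr_ge0.
    rewrite eqf_sqr => /orP[/eqP ->|/eqP ->].
      by exists false; rewrite mul1r.
    by exists true; rewrite mulN1r.
  by exists (j, (e, b)) => //; rewrite /pt /= -pi'z -zj piE.
move=> C x y cC Cx Cy /ball_circle.
have e1 z := circleE z.
have e2 z : (set_val z).2 ^+ 2 + (set_val z).1 ^+ 2 = 1 :> R.
  by rewrite addrC circleE.
have main1 := main _ _ true C _ _ e1 (fun z => surjective_pairing _)
  (@coord1_continuous R) cC.
have main2 := main _ _ false C _ _ e2 (fun z => surjective_pairing _)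
  (@coord2_continuous R) cC.
move/not_andP => [] /negP; rewrite -leNgt ler_normr => /orP[h|h].
- exact: main1 Cy Cx h.
- by apply: (main1 _ _ Cx Cy); move: h; rewrite opprB.
- exact: main2 Cy Cx h.
- by apply: (main2 _ _ Cx Cy); move: h; rewrite opprB.
Qed.

(** Provides the points on which the orientations of [rho g] and [rho' g] are compared. The empty
    set is perfect, hence the second hypothesis. *)
Lemma perfect_three_points (mu : set (circle R)) : perfect_set mu -> mu !=set0 ->
  exists x y z, [/\ mu x, mu y, mu z & [/\ x <> y, y <> z & x <> z]].
Proof.
case=> _ lmu [x mx]; have := mx; rewrite -{1}lmu => lx.
have [y [/eqP yx my _]] := lx setT filterT.
have [|z [/eqP zx mz zy]] := lx [set z | z <> y].
  have -> : [set z | z <> y] = open_arc true y y.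
    apply/seteqP; split => z; first by left.
    case=> [[]//|/ccw_neq[]]; first by move=> ? ? ?; apply/nesym.
  apply: open_nbhs_nbhs; split; first exact: open_open_arc.
  by left; split=> // /esym.
by exists x, y, z; split => //; split=> //; exact/nesym.
Qed.

End CircleMetric.

(** * Gaps as disjoint connected components *)

Section Gaps.
Context {R : realType}.
Variable mu : set (circle R).
Implicit Types (I J : gap mu) (x : circle R).

Lemma gap_connected I : connected (sval I).
Proof. by have [x _ ->] := svalP I; exact: component_connected. Qed.

Lemma gap_notin I x : sval I x -> ~ mu x.
Proof. by have [y _ ->] := svalP I; exact: connected_component_sub. Qed.

Lemma gap_inj I J : sval I = sval J -> I = J.
Proof. by move=> IJ; exact: eq_sig_hprop. Qed.

Lemma gap_eq I J x : sval I x -> sval J x -> I = J.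
Proof.
move=> Ix Jx; apply: gap_inj.
have [y _ IE] := svalP I; have [z _ JE] := svalP J.
move: Ix Jx; rewrite IE JE => yx zx.
by rewrite (same_connected_component yx) (same_connected_component zx).
Qed.

End Gaps.

(** * Faithfulness, stabilizers, subsequences and uniform limits *)

Section Actions.
Context {R : realType} {G : groupType}.
Variables (mu : set (circle R)) (sigma : G -> gap mu -> gap mu).
Implicit Types (I J : gap mu) (rho : G -> circle R -> circle R) (g h : G).

Lemma expgz_conj g h n : expgz (g * h * g^-1)%g n = (g * expgz h n * g^-1)%g.
Proof.
have hX m : ((g * h * g^-1) ^+ m = g * h ^+ m * g^-1)%g.
  elim: m => [|m IHm]; first by rewrite !expg0 mulg1 mulgV.
  by rewrite !expgS IHm !mulgA mulgKV.
by case: n => m /=; rewrite hX// !invgM invgK !mulgA.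
Qed.

Lemma representation_inj rho : representation rho -> faithful_on mu rho ->
  injective rho.
Proof.
case=> rhoH rhoM rhoF g h gh.
(* [rho 1] is idempotent and injective, hence the identity. *)
have rho1 x : rho 1%g x = x.
  have [f [fK _ _ _]] := rhoH 1%g; apply: (can_inj fK).
  by rewrite -[in RHS](mulg1 1%g) rhoM.
suff e : (h^-1 * g = 1)%g by rewrite -[LHS]mul1g -(mulgV h) -mulgA e mulg1.
by apply: rhoF => x _; rewrite rhoM /= gh -[LHS]/((rho _ \o rho h) x) -rhoM mulVg.
Qed.

Lemma sigma_eq_stabilizer I g h : permutation_action sigma ->
  sigma g I = sigma h I -> gap_stabilizer sigma I (h^-1 * g)%g.
Proof.
case=> sB sM e; rewrite /gap_stabilizer /= sM /= e.
have [f fK _] := sB h; apply: (can_inj fK).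
rewrite -[LHS]/((sigma h \o sigma h^-1%g) (sigma h I)) -sM mulgV.
by rewrite -[LHS]/((sigma 1%g \o sigma h) I) -sM mul1g.
Qed.

Lemma frequently_subsequence (P : nat -> Prop) :
  (forall N, exists2 n, (N <= n)%N & P n) ->
  exists2 phi : nat -> nat, {homo phi : m n / (m < n)%N} & forall n, P (phi n).
Proof.
move=> h; pose f N := s2val (cid2 (h N)).
have fN N : (N <= f N)%N := s2valP (cid2 (h N)).
have fP N : P (f N) := s2valP' (cid2 (h N)).
(* The successor makes the sequence strictly increasing, as [f N] is only known to be at least
   [N]. *)
exists (fun n => iter n (fun m => f m.+1) (f 0)); last first.
  by case=> [|n]; exact: fP.
by apply: homo_ltn => [m n p|n]; [exact: ltn_trans | exact: fN].
Qed.

Lemma near_finite_set (T : choiceType) (F : set T) (P : T -> nat -> Prop) :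
  finite_set F -> (forall p, F p -> \forall n \near \oo, P p n) ->
  \forall n \near \oo, forall p, F p -> P p n.
Proof.
move=> /finite_fsetP[D ->] h.
have := @filter_bigI _ _ D P \oo _ h.
by move=> [N _ hN]; exists N => // n /hN hn p Dp; exact: hn.
Qed.

Lemma uniform_cst_ballP (K : set (circle R)) (f : nat -> circle R -> circle R)
    (x : circle R) :
  {uniform K, f @ \oo --> (fun=> x)} <->
  forall e : R, 0 < e -> \forall n \near \oo, forall y, K y -> ball x e (f n y).
Proof.
split=> [h e e0|h U].
  suff : nbhs ((fun=> x) : {uniform` K -> circle R})
      [set g | forall y, K y -> ball x e (g y)] by move=> /h.
  apply/uniform_nbhs; exists [set xy | ball xy.1 e xy.2]; split=> //.
  by rewrite -entourage_from_ballE; exists e.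
move=> /uniform_nbhs[E [+ EU]]; rewrite -entourage_from_ballE => -[e /= e0 eE].
have [N _ hN] := h e e0; exists N => // n /hN hn; apply: EU => y Ky.
by apply: eE; exact: hn.
Qed.

End Actions.

(** * Transfer of convergence between two representations agreeing off the orbit of a gap *)

Section Transfer.
Context {R : realType} {G : groupType}.
Variables (mu : set (circle R)) (tau : circle R -> circle R).
Variables (sigma : G -> gap mu -> gap mu) (I0 : gap mu).
Implicit Types (I J : gap mu) (rho : G -> circle R -> circle R) (g h : G).
Variables (rho rho' : G -> circle R -> circle R).
Hypothesis sigmaP : permutation_action sigma.
Hypothesis rhoP : mts_representation tau sigma rho.
Hypothesis rhoP' : mts_representation tau sigma rho'.
Hypothesis rho_off : forall g x, ~ gap_orbit sigma I0 x -> rho' g x = rho g x.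

Lemma modification_on_mu g x : mu x -> rho' g x = rho g x.
Proof. by move=> mx; apply: rho_off => -[h _ /gap_notin]. Qed.

(** A gap that is not small meets the finite transversal. Each point of the latter lies in at most
    one gap, which the images eventually avoid. *)
Lemma near_gap_small (v : nat -> G) h (d : R) : 0 < d ->
  (forall J, \forall n \near \oo, sigma (v n * h)%g I0 <> J) ->
  \forall n \near \oo, forall y z, sval (sigma (v n * h)%g I0) y ->
    sval (sigma (v n * h)%g I0) z -> ball y d z.
Proof.
move=> d0 vJ; have [F finF Ftrans] := finite_transversal d0.
have : \forall n \near \oo, forall p, F p -> ~ sval (sigma (v n * h)%g I0) p.
  apply: near_finite_set => // p _.
  have [[J Jp]|nJ] := pselect (exists J, sval J p); last first.
    by exists 0%N => // n _ np; apply: nJ; exists (sigma (v n * h)%g I0).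
  have [N _ hN] := vJ J; exists N => // n /hN nJ np; apply: nJ.
  exact: gap_eq np Jp.
move=> [N _ hN]; exists N => // n /hN hn y z ny nz.
apply: contrapT => yz.
have [p [np Fp]] :=
  Ftrans _ _ _ (@gap_connected _ _ (sigma (v n * h)%g I0)) ny nz yz.
exact: hn Fp np.
Qed.

(* A gap meeting [K] either is so small that it stays in the compact set [K1],
   or is one of finitely many, whose images shrink by [near_gap_small]. *)
Lemma modification_uniform (v : nat -> G) (A K : set (circle R)) (x : circle R) :
  open A -> compact K -> K `<=` A ->
  (forall K', compact K' -> K' `<=` A ->
    {uniform K', (fun n => rho (v n)) @ \oo --> (fun=> x)}) ->
  (forall h J, \forall n \near \oo, sigma (v n * h)%g I0 <> J) ->
  {uniform K, (fun n => rho' (v n)) @ \oo --> (fun=> x)}.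
Proof.
move=> oA cK KA unif vJ; apply/uniform_cst_ballP => e e0.
have [d d0 dA] := compact_subset_open_ball cK oA KA.
have d20 : 0 < d / 2 by rewrite divr_gt0.
have e20 : 0 < e / 2 by rewrite divr_gt0.
(* Half of [d] leaves room for the closure to remain in [A]. *)
pose K1 := closure (\bigcup_(y in K) ball y (d / 2)).
have subK1 y z : K y -> ball y (d / 2) z -> K1 z.
  by move=> Ky yz; apply: subset_closure; exists y.
have K1A : K1 `<=` A.
  move=> z /(_ (ball z (d / 2))) [|w [[y Ky yw] zw]]; first exact: nbhsx_ballx.
  by apply: (dA y Ky); apply: (ball_split yw); exact: ball_sym.
have cK1 : compact K1.
  exact: subclosed_compact (@closed_closure _ _) circle_compact _.
have [F finF Ftrans] := finite_transversal d20.
have n1 := (uniform_cst_ballP _ _ _).1 (unif K1 cK1 K1A) _ e20.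
(* Infinitely many [h] may give the gap containing [p], but its image depends only on the gap, so
   one [h] per point [p] suffices. *)
have n2 : \forall n \near \oo, forall p, F p -> forall h, sval (sigma h I0) p ->
    forall y z, sval (sigma (v n * h)%g I0) y ->
    sval (sigma (v n * h)%g I0) z -> ball y (e / 2) z.
  apply: near_finite_set => // p _.
  have [[h hp]|nh] := pselect (exists h, sval (sigma h I0) p); last first.
    by exists 0%N => // n _ h hp; case: nh; exists h.
  have [N _ hN] := near_gap_small e20 (vJ h).
  exists N => // n /hN hn h' hp'; have := gap_eq hp hp' => hh'.
  have -> // : sigma (v n * h')%g I0 = sigma (v n * h)%g I0.
  by rewrite !sigmaP.2 /= hh'.
have [N1 _ hN1] := n1; have [N2 _ hN2] := n2.
exists (maxn N1 N2) => // n; rewrite /= geq_max => /andP[/hN1 hn1 /hN2 hn2] y Ky.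
have K1y : K1 y by apply: (subK1 y) => //; exact: ballxx.
have [[h _ hy]|yJ] := pselect (gap_orbit sigma I0 y); last first.
  rewrite rho_off//; apply: le_ball (hn1 y K1y).
  by rewrite ler_pdivrMr// ler_peMr// ?ler1n// ltW.
have imE r : mts_representation tau sigma r -> r (v n) @` sval (sigma h I0) =
    sval (sigma (v n * h)%g I0).
  by case=> _ _ _ _ ->; rewrite sigmaP.2.
have ny : sval (sigma (v n * h)%g I0) (rho (v n) y).
  by rewrite -(imE rho)//; exists y.
have ny' : sval (sigma (v n * h)%g I0) (rho' (v n) y).
  by rewrite -(imE rho')//; exists y.
(* The point [rho' (v n) y] is [rho (v n) z] for some [z] in the gap of [y]. If [z] is close to [y],
   it lies in [K1]; otherwise the gap meets [F], and its image is small and contains [rho (v n) y],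
   already near [x]. *)
have := ny'; rewrite -(imE rho)// => -[z hz yz].
have [byz|byz] := pselect (ball y (d / 2) z).
  rewrite -yz; apply: le_ball (hn1 z (subK1 _ _ Ky byz)).
  by rewrite ler_pdivrMr// ler_peMr// ?ler1n// ltW.
have [p [hp Fp]] := Ftrans _ _ _ (@gap_connected _ _ (sigma h I0)) hy hz byz.
by apply: (ball_split (hn1 y K1y)); exact: (hn2 p Fp h hp).
Qed.

(** Agreement off the orbit of [I0] is symmetric in [rho] and [rho'], so this implication serves in
    both directions. *)
Lemma modification_almost_convergence (k : nat) (o : bool) (c : G) :
  perfect_set mu -> faithful_on mu rho ->
  gap_stabilizer sigma I0 = range (expgz c) ->
  almost_convergence mu tau k o rho -> almost_convergence mu tau k o rho'.
Proof.
move=> pmu rhoF stabI0 ac u.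
have [rhoR [[[_ mu0 _] _] _] _ _ rhoS] := rhoP.
have [rhoR' _ _ _ rhoS'] := rhoP'.
have rho_inj := representation_inj rhoR rhoF.
have [phi [phi_mono phiP]] := ac u.
have [[N vN]|[a [g [p [[I gI] vE]]]]|[xm [xp [mxm mxp conv]]]] := phiP.
- exists phi; split=> //; apply: Or31; exists N => n Nn.
  by rewrite (rho_inj _ _ (vN n Nn)).
- exists phi; split=> //; apply: Or32; exists a, g, p; split.
    by exists I; rewrite rhoS' -rhoS.
  by move=> n; rewrite -rhoR'.2; congr rho'; apply: rho_inj; rewrite vE rhoR.2.
pose v := u \o phi.
have [[h [J freq]]|nfreq] := pselect (exists h J, forall N,
    exists2 n, (N <= n)%N & sigma (v n * h)%g I0 = J).
  have [psi psi_mono psiP] := frequently_subsequence freq.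
  exists (phi \o psi); split; first by move=> m n /psi_mono/phi_mono.
  (* Each [v (psi n) * h] sends [I0] to [J], as [b] does, so it equals [b * c ^ m] for some [m].
     Hence [v (psi n)] is [(b * c * b^-1) ^ m * v (psi 0)], and [b * c * b^-1] fixes [J]. *)
  pose b := (v (psi 0%N) * h)%g.
  apply: Or32; exists (v (psi 0%N)), (b * c * b^-1)%g.
  have stab n : exists m, expgz c m = (b^-1 * (v (psi n) * h))%g.
    have : gap_stabilizer sigma I0 (b^-1 * (v (psi n) * h))%g.
      by apply: sigma_eq_stabilizer => //; rewrite !psiP.
    by rewrite stabI0 => -[m _ <-]; exists m.
  exists (fun n => projT1 (cid (stab n))); split.
    exists (sigma b I0); rewrite rhoS'; congr sval.
    have cI0 : sigma c I0 = I0.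
      have : gap_stabilizer sigma I0 c by rewrite stabI0; exists 1.
      by [].
    by rewrite -[LHS]/((sigma _ \o sigma b) I0) -sigmaP.2 mulgKV sigmaP.2 /= cI0.
  move=> n; rewrite -rhoR'.2; congr rho'.
  rewrite expgz_conj; case: (cid _) => m /= ->.
  by rewrite /b !mulgA mulgV mul1g !invgM !mulgA; rewrite !mulgKV ?mulgK.
have vJ h J : \forall n \near \oo, sigma (v n * h)%g I0 <> J.
  apply: contrapT => nn; apply: nfreq; exists h, J => N.
  apply: contrapT => nN; apply: nn; exists N => // n /= Nn e.
  by apply: nN; exists n.
have [x [y [z [mx my mz [xy yz xz]]]]] := perfect_three_points pmu mu0.
have orient g := orientation_eq_on3 xy yz xz (rhoR'.1 g)
  (esym (modification_on_mu g mx)) (esym (modification_on_mu g my))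
  (esym (modification_on_mu g mz)).
exists phi; split=> //; apply: Or33; exists xm, xp; split=> //=.
by case: conv => -[ori conv]; [left|right]; split;
  [move=> n; exact: (orient _).1 (ori n) | move=> i ik K cK KA;
   exact: modification_uniform (open_open_arc _ _ _) cK KA (conv i ik) vJ
  |move=> n; exact: (orient _).2 (ori n) | move=> i ik K cK KA;
   exact: modification_uniform (open_open_arc _ _ _) cK KA (conv i ik) vJ].
Qed.

End Transfer.

Theorem theorem3p10 (R : realType) (G : groupType) (q : nat) (c : 'I_q -> G)
    (k : nat) (o : bool) (mu : set (circle R)) (tau : circle R -> circle R)
    (sigma : G -> gap mu -> gap mu) (rho rho' : G -> circle R -> circle R)
    (i : 'I_q) (I0 : gap mu) (f0 : circle R -> circle R) :
  orbifold_group c ->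
  circular_data mu tau k o ->
  permutation_action sigma ->
  mts_representation tau sigma rho ->
  faithful_on mu rho ->
  non_elementary rho ->
  modification tau sigma (c i) rho I0 f0 rho' ->
  (almost_convergence mu tau k o rho' <-> almost_convergence mu tau k o rho).
Proof.
move=> _ [pmu _ _ _ _] sigmaP rhoP rhoF _ [[_ stab] _ rhoP' off _].
have rhoF' : faithful_on mu rho'.
  move=> g fg; apply: rhoF => x mx.
  by rewrite -(modification_on_mu off)// fg.
split; last first.
  exact: (modification_almost_convergence sigmaP rhoP rhoP' off pmu rhoF stab).
apply: (modification_almost_convergence sigmaP rhoP' rhoP _ pmu rhoF' stab).
by move=> g x xJ; rewrite off.
Qed.
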